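(* Let $\beta>1$ be an integer, fix $k\in\mathbb{N}$ (with $k\geq 1$), and let $u=\beta^{-k}$. Let the numbers $B_n$ ($n\geq 1$) and $F_n$ ($n\in\mathbb{Z}$) be as defined in the context. The following statements are equivalent: (i) The following equations hold: \[ B_n=(n-1)\frac{\beta-1}{\beta}u+u\quad\text{if } 1\leq n\leq k+1, \] \[ B_{n+1}=B_n+\frac{\beta-1}{\beta}u\,(1-B_{n-k})\quad\text{if } n\geq k+1. \] (ii) The sequence $(F_n)_{n\in\mathbb{Z}}$ satisfies \[ F_n=\begin{cases}0 & \text{if } n<1,\\ 1 & \text{if } n=1,\\ (\beta-1)(F_{n-1}+F_{n-2}+\dots+F_{n-k}) & \text{if } n\geq 2.\end{cases} \] In particular, $F_n=(\beta-1)\beta^{n-2}$ for $2\leq n\leq k+1$.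
   Context: Let $f:[0,1)\to[0,1)$, $f(x)=\beta x\pmod 1$, be the Rényi map with integer $\beta>1$. For $k\in\mathbb{N}$ fixed and $u=\beta^{-k}$, define for each integer $i\geq 0$ the set $E_i=\{x\in[0,1): f^i(x)>1-u\}$, where $f^i$ is the $i$-th iterate of $f$, and for $n\geq 1$ define \[ B_n=\mathrm{Leb}\Big(\bigcup_{i=0}^{n-1}E_i\Big), \] where $\mathrm{Leb}$ is Lebesgue measure; in particular $B_1=u$. For $n\in\mathbb{Z}$ define \[ F_n=\begin{cases}0 & \text{if } n<1,\\ 1 & \text{if } n=1,\\ \dfrac{B_n-B_{n-1}}{u/\beta^{n-1}} & \text{if } n>1.\end{cases} \] *)

(* Defs.v *)
From HB Require Import structures.
From mathcomp Require Import all_boot all_order all_algebra.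
From mathcomp Require Import all_classical all_reals all_analysis.

Set Implicit Arguments.
Unset Strict Implicit.
Unset Printing Implicit Defensive.

Import Order.TTheory GRing.Theory Num.Theory.
Import numFieldNormedType.Exports.

Local Open Scope classical_set_scope.
Local Open Scope ring_scope.

Definition renyi_map (R : realType) (b : nat) (x : R) : R :=
  b%:R * x - (Num.floor (b%:R * x))%:~R.

Definition renyi_u (R : realType) (b k : nat) : R := b%:R ^- k.

Definition renyi_E (R : realType) (b k i : nat) : set R :=
  [set x : R | 0 <= x < 1 /\ 1 - renyi_u R b k < iter i (renyi_map b) x].

Arguments renyi_E : clear implicits.

(* The union is contained in [0, 1[, so its measure is finite and fine
   loses no information. *)
Definition renyi_B (R : realType) (b k n : nat) : R :=
  fine (lebesgue_measure (\bigcup_(i < n) renyi_E R b k i)).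

Definition renyi_F (R : realType) (b k : nat) (n : int) : R :=
  if n < 1 then 0
  else if n == 1 then 1
  else (renyi_B R b k `|n|%N - renyi_B R b k `|n - 1|%N) /
       (renyi_u R b k / b%:R ^ (n - 1)).

Definition B_recurrence (R : realType) (b k : nat) (B : nat -> R) : Prop :=
  (forall n : nat, (1 <= n <= k.+1)%N ->
     B n = (n%:R - 1) * ((b%:R - 1) / b%:R) * renyi_u R b k + renyi_u R b k) /\
  (forall n : nat, (k.+1 <= n)%N ->
     B n.+1 = B n + (b%:R - 1) / b%:R * renyi_u R b k * (1 - B (n - k)%N)).

Definition F_recurrence (R : realType) (b k : nat) (F : int -> R) : Prop :=
  forall n : int,
    F n = if n < 1 then 0
          else if n == 1 then 1
          else (b%:R - 1) * \sum_(1 <= j < k.+1) F (n - j%:Z).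

(* Main.v *)
Require Import Defs.
From HB Require Import structures.
From mathcomp Require Import all_boot all_order all_algebra.
From mathcomp Require Import all_classical all_reals all_analysis.
From mathcomp Require Import zify ring lra.

Set Implicit Arguments.
Unset Strict Implicit.
Unset Printing Implicit Defensive.

Import Order.TTheory GRing.Theory Num.Theory.
Import numFieldNormedType.Exports.

Local Open Scope classical_set_scope.
Local Open Scope ring_scope.

(** Dynamics enters only through [B_0 = 0] and [B_1 = u]: the equivalence is an
    algebraic fact about any sequence [B] with these two values and its
    rescaled increments [F_(d+1) = (B_(d+1) - B_d) b^d / u].

    Put [H_m = b^m (1 - B_(m+1-k))], where the truncated index makes
    [B_(m+1-k)] vanish while [m + 1 <= k].  Thanks to this truncation, the two
    regimes of (i) merge into the single equation [F_(m+2) = (b-1) H_m]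
    ([B_recurrenceP]).  Let [G_m = F_(m+1) + ... + F_(m+2-k)] be the window sum
    of (ii), which says [F_(m+2) = (b-1) G_m] ([F_recurrenceP]).  Both [H] and
    [G] start at 1; moreover
      [H_(m+1) = b H_m - F_(m+2-k)], by the definition of [F]
      ([survival_weightS]), and
      [G_(m+1) = G_m + F_(m+2) - F_(m+2-k)], by sliding the window
      ([window_sumS]).
    As soon as [F_(m+2)] is [(b-1) H_m] or [(b-1) G_m], both recursions agree,
    so [G = H] by induction and (i) and (ii) say the same thing.  For
    [m < k] one has [H_m = b^m], whence the closed form
    [F_(m+2) = (b-1) b^m] of the first values. *)

(** * Sequences and their rescaled increments *)

(** The clause [F 1 = 1] amounts to [B 1 = u], and [b^(d+k)] is [b^d / u]. *)
Record rescaled_increments (R : realType) (b k : nat) (B : nat -> R)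
    (F : int -> R) : Prop := RescaledIncrements {
  increments_B0 : B 0%N = 0;
  increments_nonpos : forall n : int, n < 1 -> F n = 0;
  increments_F1 : F 1 = 1;
  incrementsE : forall d : nat,
    F d.+1%:Z = (B d.+1 - B d) * b%:R ^+ (d + k) }.

Definition window_sum (R : realType) (k : nat) (F : int -> R) (n : int) : R :=
  \sum_(1 <= j < k.+1) F (n - j%:Z).

(** For the map, [1 - B_j] is the measure of the points that stay out of the
    hole [x > 1 - u] at the times [0, ..., j-1].  The factor [b^m] is chosen to
    make the one-step equation of (i) read [F_(m+2) = (b-1) H_m]. *)
Definition survival_weight (R : realType) (b k : nat) (B : nat -> R)
    (m : nat) : R := b%:R ^+ m * (1 - B (m.+1 - k)%N).

Lemma window_sumS (R : realType) (k : nat) (F : int -> R) (n : int) :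
  window_sum k F (n + 1) = window_sum k F n + F n - F (n - k%:Z).
Proof.
rewrite /window_sum !big_add1 /=.
have shift (j : nat) : F (n + 1 - j.+1%:Z) = F (n - j%:Z) by congr F; lia.
under eq_bigr do rewrite shift.
(* Split off the last, then the first, term of the union of both windows. *)
have := erefl (\sum_(0 <= j < k.+1) F (n - j%:Z)).
rewrite {1}big_nat_recr // big_nat_recl //= subr0.
by move/(canRL (addrK _)) => ->; ring.
Qed.

(** All terms of the window but the first have nonpositive index. *)
Lemma window_sum2 (R : realType) (k : nat) (F : int -> R) (hk : (1 <= k)%N)
    (F_nonpos : forall n : int, n < 1 -> F n = 0) :
  window_sum k F 2 = F 1.
Proof.
rewrite /window_sum big_ltn // big_nat big1 ?addr0 // => j /andP[j2 _].
by apply: F_nonpos; lia.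
Qed.

Lemma survival_weight_small (R : realType) (b k : nat) (B : nat -> R)
    (m : nat) (B0 : B 0%N = 0) (lt_mk : (m < k)%N) :
  survival_weight b k B m = b%:R ^+ m.
Proof.
by rewrite /survival_weight (_ : m.+1 - k = 0)%N ?B0 ?subr0 ?mulr1 //; lia.
Qed.

(** Passing from [1 - B_d] to [1 - B_(d+1)] removes one increment of [B], which
    is [F_(d+1)] up to the scale [b^(d+k)]. *)
Lemma survival_weightS (R : realType) (b k : nat) (B : nat -> R)
    (F : int -> R) (BF : rescaled_increments b k B F) (m : nat) :
  survival_weight b k B m.+1 =
    b%:R * survival_weight b k B m - F (m.+2%:Z - k%:Z).
Proof.
have [lt_mk | le_km] := ltnP m.+1 k.
  rewrite !survival_weight_small ?(increments_B0 BF) //; last exact: ltnW.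
  by rewrite (increments_nonpos BF) ?subr0 ?exprS //; lia.
rewrite (_ : m.+2%:Z - k%:Z = (m.+1 - k).+1%:Z); last lia.
rewrite (incrementsE BF) /survival_weight subnK // subSn // exprS; ring.
Qed.

Lemma increments_B1 (R : realType) (b k : nat) (B : nat -> R) (F : int -> R)
    (hb : (1 < b)%N) (BF : rescaled_increments b k B F) :
  B 1%N = renyi_u R b k.
Proof.
have bk0 : b%:R ^+ k != 0 :> R by rewrite expf_neq0 // pnatr_eq0; lia.
apply: (mulIf bk0); rewrite /renyi_u mulVf // -[RHS](increments_F1 BF).
by rewrite (incrementsE BF 0) (increments_B0 BF) subr0.
Qed.

(** * The two recurrences in terms of the rescaled increments *)

Lemma increment_step (R : realType) (b k : nat) (B : nat -> R) (F : int -> R)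
    (hb : (1 < b)%N) (BF : rescaled_increments b k B F) (m : nat) :
  F m.+2%:Z = (b%:R - 1) * survival_weight b k B m <->
  B m.+2 = B m.+1 +
    (b%:R - 1) / b%:R * renyi_u R b k * (1 - B (m.+1 - k)%N).
Proof.
have b0 : b%:R != 0 :> R by rewrite pnatr_eq0; lia.
have bm0 : b%:R ^+ m != 0 :> R by rewrite expf_neq0.
have bk0 : b%:R ^+ k != 0 :> R by rewrite expf_neq0.
rewrite (incrementsE BF) /survival_weight /renyi_u addSn exprS exprD.
split=> [step | ->]; last by field; rewrite b0 bk0.
have c0 : b%:R * (b%:R ^+ m * b%:R ^+ k) != 0 :> R by rewrite !mulf_neq0.
apply: (addIr (- B m.+1)); apply: (mulIf c0); rewrite step.
by field; rewrite b0 bk0.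
Qed.

Lemma B_recurrenceP (R : realType) (b k : nat) (B : nat -> R) (F : int -> R)
    (hb : (1 < b)%N) (BF : rescaled_increments b k B F) :
  B_recurrence b k B <->
  forall m : nat, F m.+2%:Z = (b%:R - 1) * survival_weight b k B m.
Proof.
have B0 := increments_B0 BF.
split=> [[Bsmall Blarge] m | FH].
  apply/(increment_step hb BF).
  have [lt_mk | le_km] := ltnP m k; last by rewrite -Blarge.
  (* In the linear regime the truncated index is 0. *)
  rewrite (_ : m.+1 - k = 0)%N; last lia.
  rewrite B0 !Bsmall; [|lia|lia].
  by rewrite -(natr1 m.+1); ring.
have step m := proj1 (increment_step hb BF m) (FH m).
split=> [|[//|m] le_km]; last exact: step.
elim=> [//|[|m] IHm] lt_mk.
  by rewrite (increments_B1 hb BF) subrr !mul0r add0r.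
rewrite step IHm; last lia.
rewrite (_ : m.+1 - k = 0)%N; last lia.
by rewrite B0 -(natr1 m.+1); ring.
Qed.

Lemma F_recurrenceP (R : realType) (b k : nat) (F : int -> R)
    (F_nonpos : forall n : int, n < 1 -> F n = 0) (F1 : F 1 = 1) :
  F_recurrence b k F <->
  forall m : nat, F m.+2%:Z = (b%:R - 1) * window_sum k F m.+2%:Z.
Proof.
split=> [Frec m | FG n]; first by rewrite {1}Frec.
have [/F_nonpos // | n_ge1] := ltP n 1.
have [-> // | n_neq1] := eqVneq n 1.
have [m ->] : exists m : nat, n = m.+2%:Z by exists `|n - 2|%N; lia.
exact: FG.
Qed.

(** If [F_(m+2)] is [(b-1)] times either quantity, the recursions
    [window_sumS] and [survival_weightS] coincide, so the common initial
    value 1 propagates. *)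
Lemma window_sum_survival_weight (R : realType) (b k : nat) (B : nat -> R)
    (F : int -> R) (hk : (1 <= k)%N) (BF : rescaled_increments b k B F)
    (FGH : (forall m : nat,
              F m.+2%:Z = (b%:R - 1) * survival_weight b k B m) \/
           (forall m : nat,
              F m.+2%:Z = (b%:R - 1) * window_sum k F m.+2%:Z)) (m : nat) :
  window_sum k F m.+2%:Z = survival_weight b k B m.
Proof.
elim: m => [|m IHm].
  rewrite window_sum2 //; last exact: increments_nonpos BF.
  by rewrite (increments_F1 BF) survival_weight_small ?(increments_B0 BF).
have FmE : F m.+2%:Z = (b%:R - 1) * survival_weight b k B m.
  by case: FGH => ->; rewrite ?IHm.
rewrite (_ : m.+3%:Z = m.+2%:Z + 1); last lia.
by rewrite window_sumS (survival_weightS BF) IHm FmE; ring.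
Qed.

Lemma B_recurrence_iff_F_recurrence (R : realType) (b k : nat) (B : nat -> R)
    (F : int -> R) (hb : (1 < b)%N) (hk : (1 <= k)%N)
    (BF : rescaled_increments b k B F) :
  B_recurrence b k B <-> F_recurrence b k F.
Proof.
rewrite (B_recurrenceP hb BF).
rewrite (F_recurrenceP _ _ (increments_nonpos BF) (increments_F1 BF)).
split=> FE m.
  by rewrite (window_sum_survival_weight hk BF) //; left.
by rewrite -(window_sum_survival_weight hk BF) //; right.
Qed.

Lemma F_recurrence_small (R : realType) (b k : nat) (B : nat -> R)
    (F : int -> R) (hk : (1 <= k)%N) (BF : rescaled_increments b k B F)
    (Frec : F_recurrence b k F) (m : nat) (lt_mk : (m < k)%N) :
  F m.+2%:Z = (b%:R - 1) * b%:R ^+ m.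
Proof.
have FG := proj1 (F_recurrenceP _ _ (increments_nonpos BF) (increments_F1 BF))
  Frec.
rewrite FG (window_sum_survival_weight hk BF); last by right.
by rewrite survival_weight_small ?(increments_B0 BF).
Qed.

(** * The sequences of the Renyi map *)

Lemma renyi_B0 (R : realType) (b k : nat) : renyi_B R b k 0 = 0.
Proof. by rewrite /renyi_B bigcup_mkord big_ord0 measure0. Qed.

Lemma renyi_B1 (R : realType) (b k : nat) (hb : (1 < b)%N) :
  renyi_B R b k 1 = renyi_u R b k.
Proof.
have b_ge1 : 1 <= b%:R :> R by rewrite ler1n; lia.
have u_gt0 : 0 < renyi_u R b k.
  by rewrite invr_gt0 exprn_gt0 // (lt_le_trans ltr01).
have u_le1 : renyi_u R b k <= 1.
  by rewrite invf_le1 ?exprn_ege1 // exprn_gt0 // (lt_le_trans ltr01).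
rewrite /renyi_B bigcup_mkord big_ord1.
(* Since u <= 1, the constraint 0 <= x follows from 1 - u < x. *)
have -> : renyi_E R b k 0 = `]1 - renyi_u R b k, 1[%classic.
  apply/seteqP; split=> x; rewrite /renyi_E /= in_itv /=.
    by case=> /andP[_ ->] ->.
  by move=> /andP[lt_ux ->]; split=> //; rewrite andbT; lra.
rewrite lebesgue_measure_itv /= lte_fin ifT; last lra.
by rewrite -EFinB /=; lra.
Qed.

Lemma renyi_rescaled_increments (R : realType) (b k : nat) (hb : (1 < b)%N) :
  rescaled_increments b k (renyi_B R b k) (renyi_F R b k).
Proof.
have b0 : b%:R != 0 :> R by rewrite pnatr_eq0; lia.
have bk0 : b%:R ^+ k != 0 :> R by rewrite expf_neq0.
split=> [| n n_lt1 | | [|d]]; rewrite ?renyi_B0 //.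
- by rewrite /renyi_F n_lt1.
- by rewrite subr0 (renyi_B1 _ _ hb) /renyi_F /= /renyi_u mulVf.
have bd0 : b%:R ^+ d.+1 != 0 :> R by rewrite expf_neq0.
rewrite /renyi_F /= /renyi_u (_ : d.+2%:Z - 1 = d.+1%:Z); last lia.
by rewrite -exprnP exprD; field; rewrite bd0 bk0.
Qed.

Theorem lemma2p2 (R : realType) (b k : nat) (hb : (1 < b)%N) (hk : (1 <= k)%N) :
  (B_recurrence b k (renyi_B R b k) <-> F_recurrence b k (renyi_F R b k)) /\
  (F_recurrence b k (renyi_F R b k) ->
   forall n : int, 2 <= n <= k%:Z + 1 ->
     renyi_F R b k n = (b%:R - 1) * b%:R ^ (n - 2)).
Proof.
have BF := renyi_rescaled_increments R k hb.
split; first exact: B_recurrence_iff_F_recurrence.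
move=> Frec n n_range.
have [m nE] : exists m : nat, n = m.+2%:Z by exists `|n - 2|%N; lia.
rewrite nE (F_recurrence_small hk BF Frec); last lia.
by rewrite (_ : m.+2%:Z - 2 = m%:Z) -?exprnP //; lia.
Qed.
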